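(* Let $X$ be a Hausdorff space and let $\varphi\colon X\to X$ be an attracting map with a local repellor such that $\operatorname{Fix}(\varphi)$ is a finite union of sets each of which is a retract of $X$ and a pointwise attractor of some iterated function system on $X$. Then there exists a finite family $\mathcal{F}$ of continuous maps $X\to X$ containing $\varphi$ such that $\operatorname{Fix}(\varphi)$ is a pointwise attractor of the iterated function system $(X,\mathcal{F})$ with pointwise basin $B_p(\operatorname{Fix}(\varphi),\mathcal{F})=X$, but $\operatorname{Fix}(\varphi)$ is not a strict attractor of $(X,\mathcal{F})$.
   Context: $\mathbb{N}=\{0,1,2,\dots\}$. An iterated function system (IFS) is a pair $(X,\mathcal{F})$ where $X$ is a Hausdorff space and $\mathcal{F}$ is a finite family of continuous maps $X\to X$. $\mathcal{K}(X)$ is the set of all nonempty compact subsets of $X$ with the Vietoris topology, i.e. the topology with basis the sets $\langle U_1,\dots,U_n\rangle=\{S\in\mathcal{K}(X): S\subset\bigcup_{i=1}^n U_i \text{ and } S\cap U_i\neq\emptyset \text{ for all } i\}$ with $U_1,\dots,U_n$ open in $X$. For $S\subset X$ put $\mathcal{F}(S)=\bigcup_{f\in\mathcal{F}}f(S)$, let $\mathcal{F}^n$ denote the $n$-th iterate of this operator, and write $\mathcal{F}^n(x)$ for $\mathcal{F}^n(\{x\})$. Limits of sequences of compact sets are taken in the Vietoris topology. A strict attractor of $(X,\mathcal{F})$ is a set $A\in\mathcal{K}(X)$ that has an open neighborhood $U\supset A$ such that $A=\lim_{n\to\infty}\mathcal{F}^n(S)$ for every $S\in\mathcal{K}(X)$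 with $S\subset U$. A pointwise attractor of $(X,\mathcal{F})$ is a set $A\in\mathcal{K}(X)$ that is contained in the interior of its pointwise basin $B_p(A,\mathcal{F})=\{x\in X: \lim_{n\to\infty}\mathcal{F}^n(x)=A\}$. $\operatorname{Fix}(\varphi)$ is the set of fixed points of $\varphi$. A continuous map $\varphi\colon X\to X$ on a Hausdorff space $X$ is called an attracting map if for every $x\in X$ the limit $\lim_{n\to\infty}\varphi^n(x)$ exists and belongs to $\operatorname{Fix}(\varphi)$. A point $a\in\operatorname{Fix}(\varphi)$ is a local repellor of $\varphi$ if there is a sequence $(x_n)_{n\in\mathbb{N}}$ in $X$ converging to $a$ such that $x_0\notin\operatorname{Fix}(\varphi)$ and $\varphi(x_{n+1})=x_n$ for every $n\in\mathbb{N}$. A set $B\subset X$ is a retract of $X$ if there is a continuous map $r\colon X\to B$ with $r(x)=x$ for all $x\in B$. *)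

(* Defs.v *)
(* MathComp-Analysis *)
From HB Require Import structures.
From mathcomp Require Import all_boot all_order all_algebra.
From mathcomp Require Import all_classical topology.

Set Implicit Arguments.
Unset Strict Implicit.
Unset Printing Implicit Defensive.

Local Open Scope classical_set_scope.

Definition compacts (X : topologicalType) : set (set X) :=
  [set S | S !=set0 /\ compact S].

Definition hyperspace (X : topologicalType) : Type := set_type (@compacts X).

HB.instance Definition _ (X : topologicalType) := Choice.on (hyperspace X).

Definition carrier (X : topologicalType) (S : hyperspace X) : set X := set_val S.

(* The Vietoris topology. The tuple U_1, ..., U_n is represented by the finite
   set {U_1, ..., U_n}, which determines <U_1, ..., U_n>. *)
Definition finite_opens (X : topologicalType) : set (set (set X)) :=
  [set G | finite_set G /\ G `<=` open].

Definition vietoris_basic (X : topologicalType) (G : set (set X)) :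
    set (hyperspace X) :=
  [set S | carrier S `<=` \bigcup_(U in G) U /\
           forall U, G U -> carrier S `&` U !=set0].

Lemma vietoris_basic_cover (X : topologicalType) :
  \bigcup_(G in @finite_opens X) vietoris_basic G = setT.
Proof.
rewrite -subTset => S _; exists [set setT].
  by split; [exact: finite_set1 | move=> _ ->; exact: openT].
split=> [x _|_ ->]; first by exists setT.
by rewrite setIT; have [] := set_valP S.
Qed.

Lemma vietoris_basic_join (X : topologicalType) (G H : set (set X))
    (S : hyperspace X) :
  finite_opens G -> finite_opens H -> vietoris_basic G S ->
  vietoris_basic H S ->
  exists K, [/\ finite_opens K, vietoris_basic K S &
                vietoris_basic K `<=` vietoris_basic G `&` vietoris_basic H].
Proof.
move=> [finG oG] [finH oH] [SG GS] [SH HS].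
pose g := \bigcup_(U in G) U; pose h := \bigcup_(V in H) V.
have og : open g by exact: bigcup_open.
have oh : open h by exact: bigcup_open.
exists ([set U `&` h | U in G] `|` [set g `&` V | V in H]); split.
- split; first by rewrite finite_setU; split; exact: finite_image.
  by move=> _ [[U GU <-]|[V HV <-]]; apply: openI => //; [exact: oG | exact: oH].
- split=> [x Sx|_ [[U GU <-]|[V HV <-]]].
  + have [U GU Ux] := SG _ Sx; exists (U `&` h); first by left; exists U.
    by split=> //; exact: SH.
  + by have [x [Sx Ux]] := GS _ GU; exists x; do 2?split => //; exact: SH.
  + by have [x [Sx Vx]] := HS _ HV; exists x; do 2?split => //; exact: SG.
- move=> T [TK KT]; split; split.
  + move=> x /TK[_ [[U GU <-] [Ux _]|[V HV <-] [gx _]]] //; by exists U.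
  + move=> U GU; have [|x [Tx [Ux _]]] := KT (U `&` h); last by exists x.
    by left; exists U.
  + move=> x /TK[_ [[U GU <-] [_ hx]|[V HV <-] [_ Vx]]] //; by exists V.
  + move=> V HV; have [|x [Tx [_ Vx]]] := KT (g `&` V); last by exists x.
    by right; exists V.
Qed.

HB.instance Definition _ (X : topologicalType) :=
  isBaseTopological.Build (hyperspace X)
    (@vietoris_basic_cover X) (@vietoris_basic_join X).

(* All the terms of the sequence, as well as its limit, are required to be
   nonempty and compact. *)
Definition vietoris_cvg (X : topologicalType) (S : nat -> set X) (A : set X) :
    Prop :=
  exists (s : nat -> hyperspace X) (a : hyperspace X),
    [/\ forall n, carrier (s n) = S n, carrier a = A & s @ \oo --> a].

(* X is not required to be Hausdorff here: this is a hypothesis wherever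
   iterated function systems are considered. *)
Definition is_ifs (X : topologicalType) (F : set (X -> X)) : Prop :=
  finite_set F /\ forall f, F f -> continuous f.

Definition hutchinson (X : Type) (F : set (X -> X)) (S : set X) : set X :=
  \bigcup_(f in F) f @` S.

Definition strict_attractor (X : topologicalType) (F : set (X -> X))
    (A : set X) : Prop :=
  compacts A /\
  exists U : set X, [/\ open U, A `<=` U &
    forall S : set X, compacts S -> S `<=` U ->
      vietoris_cvg (fun n => iter n (hutchinson F) S) A].

Definition pointwise_basin (X : topologicalType) (F : set (X -> X))
    (A : set X) : set X :=
  [set x | vietoris_cvg (fun n => iter n (hutchinson F) [set x]) A].

Definition pointwise_attractor (X : topologicalType) (F : set (X -> X))
    (A : set X) : Prop :=
  compacts A /\ A `<=` interior (pointwise_basin F A).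

Definition Fix (X : Type) (phi : X -> X) : set X := [set x | phi x = x].

Definition attracting_map (X : topologicalType) (phi : X -> X) : Prop :=
  continuous phi /\
  forall x, exists2 y, Fix phi y & iter n phi x @[n --> \oo] --> y.

Definition local_repellor (X : topologicalType) (phi : X -> X) (a : X) : Prop :=
  Fix phi a /\
  exists x : nat -> X, [/\ x @ \oo --> a, ~ Fix phi (x 0%N) &
    forall n, phi (x n.+1) = x n].

(* The coercion of B to a type carries the subspace topology. *)
Definition is_retract (X : topologicalType) (B : set X) : Prop :=
  exists r : X -> B, continuous r /\ forall x : B, r (set_val x) = x.

(* Main.v *)
Require Import Defs.
From HB Require Import structures.
From mathcomp Require Import all_boot all_order all_algebra.
From mathcomp Require Import all_classical topology.

Local Open Scope classical_set_scope.

(** Write Fix(phi) as the union of the sets A in C, with r_A a retraction of X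
    onto A and G_A an iterated function system having A as a pointwise
    attractor. The family that works is
      F = {phi} together with all g o r_A for A in C and g in G_A.

    A Vietoris limit of a Hutchinson orbit is mapped into itself by every map of
    the system ([vietoris_limit_invariant]), so each g o r_A sends X into
    A, hence into Fix(phi). Consequently F^n(x) is contained in
    {phi^n(x)} united with Fix(phi) ([iter_hutchinson_sub]), and phi^n(x)
    converges to a fixed point: F^n(x) ends up in every neighbourhood of
    Fix(phi). In the other direction F^n(x) contains G_A^n(r_A(x)) for n > 0
    ([iter_hutchinson_retraction]), which converges to A because r_A(x) lies in
    A, hence in the basin of A; so F^n(x) eventually meets every open set that
    meets Fix(phi). Thus every point of X is in the pointwise basin.

    Strictness fails because of the local repellor a, as soon as phi is in F
    ([local_repellor_not_strict]). A backward orbit (x_n) converging to a has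
    its tail inside any given neighbourhood of Fix(phi), and this tail together
    with a is a compact set S. Yet phi^n(x_n) = x_0, hence F^n(S) contains x_0 for
    all large n and then does not lie in the complement of x_0, which is an open
    neighbourhood of Fix(phi). *)

(** * Compact sets *)

Lemma near_finite_forall (T : Type) (I : choiceType) (F : set_system T)
    (D : set I) (P : I -> T -> Prop) :
  Filter F -> finite_set D ->
  (forall i, D i -> \forall x \near F, P i x) ->
  \forall x \near F, forall i, D i -> P i x.
Proof.
move=> FF /finite_fsetP[E ->] EP.
apply: filterS (@filter_bigI T I E P F FF _).
  by move=> x xP i Ei; apply: xP.
by move=> i Ei; exact: EP.
Qed.

(** Compactness is used as a covering property relative to filters
    (near_covering), which turns a finite union into a finite intersection
    of members of a filter. *)
Lemma compact_bigcup_finite (X : topologicalType) (I : choiceType)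
    (D : set I) (f : I -> set X) :
  finite_set D -> (forall i, D i -> compact (f i)) ->
  compact (\bigcup_(i in D) f i).
Proof.
move=> finD fK; apply/compact_near_coveringP => J F P FF fP.
have : \forall j \near F, forall i, D i -> f i `<=` P j.
  apply: near_finite_forall => // i Di.
  have /compact_near_coveringP := fK i Di; apply => // x fix_.
  by apply: fP; exists i.
by apply: filterS => j jP x [i Di]; exact: jP.
Qed.

(** A neighbourhood of the limit takes care of all but finitely many terms. *)
Lemma compact_cvg_seq (X : topologicalType) (u : nat -> X) (a : X)
    (D : set nat) :
  u @ \oo --> a -> compact (a |` u @` D).
Proof.
move=> ua; apply/compact_near_coveringP => J F P FF aP.
have aPa : \near a & F, P F a by apply: aP; left.
have [[U W] /= [Ua FW] UW] := aPa.
have [M _ MU] := ua _ Ua.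
(* Only the terms of index below M can lie outside the neighbourhood U of a. *)
have : \forall j \near F, forall n, (D `&` `I_M) n -> P j (u n).
  apply: near_finite_forall; first exact: finite_setIr.
  move=> n [Dn _].
  have [|[U' W'] /= [U'n FW'] UW'] := aP (u n); first by right; exists n.
  apply: filterS FW' => j W'j; apply: (UW' (u n, j)); split=> //=.
  exact: nbhs_singleton.
apply: filterS2 FW => j Wj jP x [->|[n Dn <-]].
  by apply: (UW (a, j)); split=> //=; exact: nbhs_singleton.
have [nM|Mn] := ltnP n M; first by apply: jP; split.
by apply: (UW (u n, j)); split=> //=; exact: MU.
Qed.

(** Each x in A has a neighbourhood disjoint from some neighbourhood of p, hence
    from all smaller ones; covering A relative to the filter of small
    neighbourhoods of p then gives one W that suits every x in A. *)
Lemma compact_point_separation (X : topologicalType) (A : set X) (p : X) :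
  hausdorff_space X -> compact A -> ~ A p ->
  exists V W : set X, [/\ open V, A `<=` V, nbhs p W & V `&` W = set0].
Proof.
rewrite open_hausdorff => hX /compact_near_coveringP cA nAp.
have : \forall W \near powerset_filter_from (nbhs p),
    A `<=` [set x | (~` W)^° x].
  apply: (cA _ _ (fun W x => (~` W)^° x)) => x Ax.
  have xp : x != p by apply/eqP => xp; apply: nAp; rewrite -xp.
  have [[B B'] /= [/set_mem Bx /set_mem B'p] [oB oB' /eqP BB']] := hX x p xp.
  exists (B, [set W | W `<=` B']).
    split=> /=; first exact: open_nbhs_nbhs.
    by apply: small_set_sub; exact: open_nbhs_nbhs.
  move=> [y W] /= [By WB']; apply: (@filterS _ _ _ B) => [z Bz Wz|].
    by have : (B `&` B') z by [split => //; exact: WB']; rewrite BB'.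
  exact: open_nbhs_nbhs.
move=> /near_powerset_filter_fromP[|W pW AW].
  move=> W W' WW' + x Ax => /(_ x Ax); apply: filterS => z W'z Wz.
  exact/W'z/WW'.
exists (~` W)^°, W; split=> //; first exact: open_interior.
by apply/seteqP; split=> // z [/interior_subset].
Qed.

(** * Convergence in the Vietoris topology *)

Lemma open_vietoris_basic (X : topologicalType) (G : set (set X)) :
  finite_opens G -> open (vietoris_basic G).
Proof. by move=> oG; exists [set G]; [move=> _ -> | rewrite bigcup_set1]. Qed.

Lemma nbhs_vietoris (X : topologicalType) (a : hyperspace X)
    (N : set (hyperspace X)) :
  nbhs a N ->
  exists G, [/\ finite_opens G, vietoris_basic G a & vietoris_basic G `<=` N].
Proof.
rewrite nbhsE => -[O [[D' sD <-] [G D'G Ga]] ON]; exists G; split => //.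
  exact: sD.
by move=> S GS; apply: ON; exists G.
Qed.

Section VietorisConvergence.
Context (X : topologicalType) (S : nat -> set X) (A : set X).

(** The next three lemmas split Vietoris convergence into its upper half (being
    eventually inside the neighbourhoods of the limit) and its lower half
    (eventually meeting the open sets that the limit meets). *)
Lemma vietoris_cvg_sub (V : set X) :
  vietoris_cvg S A -> open V -> A `<=` V -> \forall n \near \oo, S n `<=` V.
Proof.
move=> [s [a [sS <- sa]]] oV aV.
have : nbhs a (vietoris_basic [set V]).
  apply: open_nbhs_nbhs; split.
    by apply: (open_vietoris_basic X); split; [exact: finite_set1 | move=> _ ->].
  split; first by rewrite bigcup_set1.
  move=> _ ->; have [[x ax] _] := set_valP a.
  by exists x; split=> //; exact: aV.
move=> /sa[N _ sN]; exists N => // n /sN [+ _].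
by rewrite bigcup_set1 sS.
Qed.

Lemma vietoris_cvg_meet (U : set X) :
  vietoris_cvg S A -> open U -> A `&` U !=set0 ->
  \forall n \near \oo, S n `&` U !=set0.
Proof.
move=> [s [a [sS <- sa]]] oU aU.
have : nbhs a (vietoris_basic [set U; setT]).
  (* With setT among the opens, only the condition of meeting U remains. *)
  apply: open_nbhs_nbhs; split.
    apply: (open_vietoris_basic X); split.
      by rewrite finite_setU; split; exact: finite_set1.
    by move=> _ [->|->] //; exact: openT.
  split; first by move=> x _; exists setT => //; right.
  by move=> _ [->//|->]; rewrite setIT; have [] := set_valP a.
move=> /sa[N _ sN]; exists N => // n /sN [_ /(_ U)].
by rewrite sS; apply; left.
Qed.

Lemma vietoris_cvgI :
  (forall n, compacts (S n)) -> compacts A ->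
  (forall V, open V -> A `<=` V -> \forall n \near \oo, S n `<=` V) ->
  (forall U, open U -> A `&` U !=set0 ->
    \forall n \near \oo, S n `&` U !=set0) ->
  vietoris_cvg S A.
Proof.
move=> cS cA SV SU.
exists (fun n => exist _ (S n) (mem_set (cS n))), (exist _ A (mem_set cA)).
split=> // N /nbhs_vietoris[G [[finG oG] [/= AG GA] GN]].
have : \forall n \near \oo, forall U, G U -> S n `&` U !=set0.
  apply: near_finite_forall => // U GU; apply: SU; first exact: oG.
  exact: GA.
have : \forall n \near \oo, S n `<=` \bigcup_(U in G) U.
  by apply: SV => //; exact: bigcup_open.
by apply: filterS2 => n ? ?; apply: GN; split.
Qed.

End VietorisConvergence.

(** * Iterates of the Hutchinson operator *)

Lemma compacts_hutchinson (X : topologicalType) (F : set (X -> X))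
    (S : set X) :
  is_ifs F -> F !=set0 -> compacts S -> compacts (hutchinson F S).
Proof.
move=> [finF cF] [f Ff] [[x Sx] cS]; split.
  by exists (f x); exists f => //; exists x.
apply: compact_bigcup_finite => // g Fg; apply: continuous_compact => //.
exact/continuous_subspaceT/cF.
Qed.

Lemma compacts_iter_hutchinson (X : topologicalType) (F : set (X -> X))
    (S : set X) (n : nat) :
  is_ifs F -> F !=set0 -> compacts S -> compacts (iter n (hutchinson F) S).
Proof. by move=> iF F0 cS; elim: n => // n IH; exact: compacts_hutchinson. Qed.

(** If g moved y in A to a point outside A, separate g(y) from A by W and V. The
    n-th set of the orbit has points near y for n large, and g sends them into
    W; but these images are in the (n+1)-st set, which lies in V. *)
Lemma vietoris_limit_invariant (X : topologicalType) (G : set (X -> X))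
    (S A : set X) (g : X -> X) :
  hausdorff_space X -> compact A ->
  vietoris_cvg (fun n => iter n (hutchinson G) S) A ->
  G g -> continuous g -> A `<=` g @^-1` A.
Proof.
move=> hX cA SA Gg cg y Ay; apply: contrapT => /= nAgy.
have [V [W [oV AV gyW VW]]] := compact_point_separation X A (g y) hX cA nAgy.
have : \forall n \near \oo, iter n (hutchinson G) S `&` g @^-1` W^° !=set0.
  apply: (vietoris_cvg_meet _ _ _ _ SA).
    by apply: open_comp; [move=> ? _; exact: cg | exact: open_interior].
  by exists y.
have [M _ MV] := vietoris_cvg_sub _ _ _ _ SA oV AV.
move=> [N _ /(_ (maxn M N) (leq_maxr _ _))[z [Sz /interior_subset Wgz]]].
have : (V `&` W) (g z); last by rewrite VW.
split=> //; apply: (MV (maxn M N).+1); first by rewrite /= leqW ?leq_maxl.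
by exists g => //; exists z.
Qed.

Lemma retraction_self_map (X : topologicalType) (A : set X) :
  is_retract A -> exists r : X -> X,
    [/\ continuous r, forall x, A (r x) & forall x, A x -> r x = x].
Proof.
move=> [r [cr rK]]; exists (set_val \o r); split.
- move=> x; apply: continuous_comp; first exact: cr.
  exact: initial_continuous.
- by move=> x; exact: set_valP.
- move=> x Ax; have := rK (exist _ x (mem_set Ax)).
  by move=> /(congr1 set_val).
Qed.

(** From the first step on, the G-orbit of r(x) stays in A, where g o r is g. The
    inclusion starts at n = 1: for n = 0 it would compare r(x) with x. *)
Lemma iter_hutchinson_retraction (X : Type) (F G : set (X -> X)) (A : set X)
    (r : X -> X) (x : X) (n : nat) :
  (forall z, A (r z)) -> (forall z, A z -> r z = z) ->
  (forall g, G g -> A `<=` g @^-1` A) -> (forall g, G g -> F (g \o r)) ->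
  iter n.+1 (hutchinson G) [set r x] `<=`
    iter n.+1 (hutchinson F) [set x] `&` A.
Proof.
move=> rA rK GA GF; elim: n => [|n IH] y.
  move=> [g Gg [_ -> <-]]; split; last exact: GA.
  by exists (g \o r); [exact: GF | exists x].
move=> [g Gg [z /IH[Fz Az] <-]]; split; last exact: GA.
by exists (g \o r); [exact: GF | exists z => //=; rewrite rK].
Qed.

(** A point of F^n(x) is either obtained by applying phi alone or has come into
    A at some step, and then never leaves. *)
Lemma iter_hutchinson_sub (X : Type) (F : set (X -> X)) (phi : X -> X)
    (A : set X) (x : X) (n : nat) :
  A `<=` phi @^-1` A -> (forall f, F f -> f = phi \/ forall z, A (f z)) ->
  iter n (hutchinson F) [set x] `<=` iter n phi x |` A.
Proof.
move=> phiA FA; elim: n => [|n IH] y; first by left.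
move=> [f /FA[->|fA]] [z /IH Az <-]; last by right.
by case: Az => [->|Az]; [left | right; exact: phiA].
Qed.

Lemma iter_backward_orbit (X : Type) (phi : X -> X) (x : nat -> X) (n : nat) :
  (forall n, phi (x n.+1) = x n) -> iter n phi (x n) = x 0%N.
Proof. by move=> xS; elim: n => // n IH; rewrite iterSr xS. Qed.

Lemma iter_hutchinson_mem (X : Type) (F : set (X -> X)) (phi : X -> X)
    (S : set X) (x : X) (n : nat) :
  F phi -> S x -> iter n (hutchinson F) S (iter n phi x).
Proof.
move=> Fp Sx; elim: n => // n IH.
by exists phi => //; exists (iter n phi x).
Qed.

(** * The role of the local repellor *)

Lemma local_repellor_not_strict (X : topologicalType) (phi : X -> X)
    (F : set (X -> X)) (a : X) :
  hausdorff_space X -> F phi -> local_repellor phi a ->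
  ~ strict_attractor F (Fix phi).
Proof.
move=> hX Fp [fixa [x [xa nfix0 xS]]] [_ [U [oU fixU UP]]].
have [N _ NU] : \forall n \near \oo, U (x n).
  by apply: xa; apply: open_nbhs_nbhs; split => //; exact: fixU.
(* S is compact and close to Fix phi, yet contains x n for all large n, and
   phi^n takes x n back to x 0. *)
pose S := a |` x @` [set n | (N <= n)%N].
have SU : S `<=` U by move=> _ [->|[n Nn <-]]; [exact: fixU | exact: NU].
have cS : compacts S by split; [exists a; left | exact: compact_cvg_seq].
have oV : open (~` [set x 0%N]).
  by apply: closed_openC; apply: compact_closed => //; exact: compact_set1.
have [|M _ MV] := vietoris_cvg_sub _ _ _ _ (UP S cS SU) oV.
  by move=> z fixz zx0; apply: nfix0; rewrite -zx0.
have Sx0 : iter (maxn M N) (hutchinson F) S (x 0%N).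
  rewrite -(iter_backward_orbit _ _ _ (maxn M N) xS).
  apply: iter_hutchinson_mem => //; right; exists (maxn M N) => //=.
  exact: leq_maxr.
exact: MV (leq_maxl _ _) _ Sx0 erefl.
Qed.

(** * The iterated function system *)

Theorem theorem4p2 (X : topologicalType) (phi : X -> X)
    (hX : hausdorff_space X)
    (hphi : attracting_map phi)
    (hrep : exists a : X, local_repellor phi a)
    (hFix : exists C : set (set X),
      [/\ finite_set C, Fix phi = \bigcup_(A in C) A &
          forall A : set X, C A ->
            is_retract A /\
            exists G : set (X -> X), is_ifs G /\ pointwise_attractor G A]) :
  exists F : set (X -> X),
    [/\ is_ifs F, F phi, pointwise_attractor F (Fix phi),
        pointwise_basin F (Fix phi) = setT &
        ~ strict_attractor F (Fix phi)].
Proof.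
have [cphi limphi] := hphi; have [a repa] := hrep.
have [C [finC fixC CP]] := hFix.
(* For A in C, p A consists of a retraction of X onto A and of an iterated
   function system with pointwise attractor A; the value outside C is a dummy. *)
have /choice[p pP] : forall A, exists p : (X -> X) * set (X -> X), C A ->
    [/\ continuous p.1, forall x, A (p.1 x), forall x, A x -> p.1 x = x,
        is_ifs p.2 & pointwise_attractor p.2 A].
  move=> A; have [CA|] := pselect (C A); last by exists (id, set0).
  have [/retraction_self_map[r [? ? ?]] [G [? ?]]] := CP _ CA.
  by exists (r, G).
pose F := phi |` \bigcup_(A in C) [set g \o (p A).1 | g in (p A).2].
have Fphi : F phi by left.
have ifsF : is_ifs F.
  split.
    rewrite /F finite_setU; split; first exact: finite_set1.
    apply: bigcup_finite => // A CA; apply: finite_image.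
    by have [_ _ _ []] := pP _ CA.
  move=> _ [->//|[A CA [g Gg <-]]] x.
  have [cr _ _ [_ cG] _] := pP _ CA.
  by apply: continuous_comp; [exact: cr | exact: cG].
have cA A : C A -> compacts A by move=> /pP[_ _ _ _ []].
have cFix : compacts (Fix phi).
  split; first by exists a; case: repa.
  by rewrite fixC; apply: compact_bigcup_finite => // A /cA[].
have basinA A x : C A -> A x -> pointwise_basin (p A).2 A x.
  by move=> /pP[_ _ _ _ [_ Ab]] /Ab /interior_subset.
have invA A g : C A -> (p A).2 g -> A `<=` g @^-1` A.
  move=> CA Gg; have [[x Ax] kA] := cA _ CA.
  have [_ _ _ [_ cG] _] := pP _ CA.
  exact: (vietoris_limit_invariant _ _ _ _ _ hX kA (basinA _ _ CA Ax) Gg (cG _ Gg)).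
have FFix f : F f -> f = phi \/ forall z, Fix phi (f z).
  move=> [->|[A CA [g Gg <-]]]; [by left | right => z /=].
  rewrite fixC; exists A => //; apply: (invA _ _ CA Gg).
  by have [_ + _ _ _] := pP _ CA; apply.
have basinF x : pointwise_basin F (Fix phi) x.
  apply: vietoris_cvgI => // [n|V oV FixV|U oU].
  - apply: compacts_iter_hutchinson => //; first by exists phi.
    by split; [exists x | exact: compact_set1].
  - have [y fixy xy] := limphi x.
    have : \forall n \near \oo, V (iter n phi x).
      by apply: xy; apply: open_nbhs_nbhs; split=> //; exact: FixV.
    have phiFix : Fix phi `<=` phi @^-1` Fix phi by move=> z; exact: congr1.
    apply: filterS => n Vn z Fz.
    by have [->//|/FixV] := iter_hutchinson_sub _ _ _ _ x n phiFix FFix _ Fz.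
  - rewrite {1}fixC => -[y [[A CA Ay] Uy]].
    have [_ rA rK _ _] := pP _ CA.
    have : \forall n \near \oo,
        iter n (hutchinson (p A).2) [set (p A).1 x] `&` U !=set0.
      by apply: (vietoris_cvg_meet _ _ A); [exact: basinA | | exists y].
    move=> [N _ NU]; exists N.+1 => // -[//|n] Nn.
    have [z [Az Uz]] := NU n.+1 (ltnW Nn); exists z; split=> //.
    have pF g : (p A).2 g -> F (g \o (p A).1) by right; exists A => //; exists g.
    by have [] := iter_hutchinson_retraction X F _ A _ x n rA rK
      (fun g => invA A g CA) pF _ Az.
have basinT : pointwise_basin F (Fix phi) = setT.
  by apply/seteqP; split=> // x _; exact: basinF.
exists F; split=> //.
  by split=> //; rewrite basinT interiorT.
exact: local_repellor_not_strict repa.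
Qed.
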